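(* Let $M_C$ be a deterministic classical Turing machine operating in time $f(n)$, where $n$ is the input size. Then there exists a (one-tape) classically-controlled quantum Turing machine $M_Q$ operating in time $O(f(n))$ such that for every input $x$, $M_C(x)=M_Q(\ket{x})$; here, when $M_C$ halts in the halting state $h$, this equality is to be read as $M_Q(\ket{x})=\ket{M_C(x)}$ (the final state of the quantum tape is the basis state encoding the final classical tape contents).
   Context: A deterministic Turing machine (TM) is a triple $M=(K,\Sigma,\delta)$: $K$ finite set of states with initial state $s$, $\Sigma$ finite alphabet containing a blank $\#$, and $\delta: K\times\Sigma\to (K\cup\{\text{yes},\text{no},h\})\times\Sigma\times\{\leftarrow,\rightarrow,-\}$, where yes, no, $h$ (halting states) are not in $K$. Its output $M(x)$ is yes or no if that state is reached, and the final tape contents if $h$ is reached. A (one-tape) classically-controlled quantum Turing machine (CQTM) is a quintuple $M=(K,\Sigma_C,\Sigma_Q,\mathcal A,\delta)$. $K$ is a finite set of classical states with initial state $s$; $\Sigma_Q$ is a finite alphabet containing a blank $\#$, whose symbols label an orthonormal basis $\{\ket{\tau}:\tau\in\Sigma_Q\}$ of the Hilbert space $\mathbb C^{|\Sigma_Q|}$ of each quantum cell of an infinite tape; $\Sigma_C$ is a finite alphabet of classical outcomes containing $\#$ and $\overline{\#}$; $\mathcal A$ is a finite set of one-cell admissible transformations, each being a family $\{M_c\}_{c}$ of linear operators on $\mathbb C^{|\Sigma_Q|}$ with $\sum_c M_c^\dagger M_c=\mathrm{Id}$ and all outcomes $c\in\Sigma_C$, and $\mathcal A$ contains the blank test $\mathcal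 T_\#=\{M_\#=\ket{\#}\bra{\#},\,M_{\overline\#}=I-\ket{\#}\bra{\#}\}$; and $\delta:K\times\Sigma_C\to(K\cup\{\text{yes},\text{no},h\})\times\{\leftarrow,\rightarrow,-\}\times\mathcal A$ is a total classical transition function. If the machine is in state $q$ with last outcome $\tau$ and $\delta(q,\tau)=(p,D,A)$, the head moves according to $D$, then $A=\{M_c\}$ is applied to the pointed cell: if the tape state is $\ket\psi$, outcome $c$ occurs with probability $\bra\psi M_c^\dagger M_c\ket\psi$ (with $M_c$ acting on the pointed cell) and the tape becomes $M_c\ket\psi$ normalized; the new state is $p$ and the last outcome is $c$. Each transition is one time step. Initially the input state (a superposition of basis states $\ket{\tau}$ with $\tau\in(\Sigma_Q\setminus\{\#\})^n$) occupies $n$ adjacent cells, all other cells are in $\ket{\#}$, the head points at the blank cell immediately left of the input, the state is $s$ and the last outcome is taken to be $\#$. The machine halts upon reaching yes, no, or $h$; the output is yes/no respectively, or, on $h$, the state of the tape segment from the leftmost cell not in $\ket\#$ to the rightmost cell not in $\ket\#$. *)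

(* Defs.v *)
From mathcomp Require Import all_boot all_order all_algebra.
Set Implicit Arguments. Unset Strict Implicit. Unset Printing Implicit Defensive.
Import Order.TTheory GRing.Theory Num.Theory.
Local Open Scope ring_scope.

Inductive halt := HYes | HNo | HH.
Inductive dir := DL | DR | DS.
Inductive output (S : Type) := OYes | ONo | OTape of seq S.
Arguments OYes {S}. Arguments ONo {S}.

Definition move (p : int) (D : dir) : int :=
  match D with DL => p - 1 | DR => p + 1 | DS => p end.

Definition place (T : Type) (b : T) (w : seq T) (k : int) : int -> T :=
  fun i => if (k <= i) && (i < k + (size w)%:Z) then nth b w (absz (i - k)) else b.

Definition trimmed (T : eqType) (b : T) (w : seq T) : bool :=
  (w == [::]) || ((head b w != b) && (last b w != b)).

Record TM (S : finType) := MkTM {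
  tm_K : finType;
  tm_s : tm_K;
  tm_delta : tm_K -> S -> (tm_K + halt) * S * dir }.

Section Classical.
Variables (S : finType) (blank : S) (M : TM S).

Definition cconfig := ((tm_K M + halt) * int * (int -> S))%type.

Definition cstep (cf : cconfig) : cconfig :=
  let '(st, h, tp) := cf in
  match st with
  | inl q => let '(p, a, D) := tm_delta q (tp h) in
             (p, move h D, fun i => if i == h then a else tp i)
  | inr _ => cf
  end.

Definition cinit (x : seq S) : cconfig := (inl (tm_s M), 0, place blank x 1).

Definition crun (x : seq S) (T : nat) : cconfig := iter T cstep (cinit x).

Definition chalted (cf : cconfig) : bool :=
  match cf.1.1 with inr _ => true | inl _ => false end.

Definition is_input (x : seq S) : bool := all (fun a => a != blank) x.

Definition runs_in_time (f : nat -> nat) : Prop :=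
  forall x, is_input x -> exists T, (T <= f (size x))%N /\ chalted (crun x T).

Definition tm_output (x : seq S) (o : output S) : Prop :=
  exists T, let '(st, _, tp) := crun x T in
  match st, o with
  | inr HYes, OYes => True
  | inr HNo, ONo => True
  | inr HH, OTape w => trimmed blank w /\ exists k, forall i, tp i = place blank w k i
  | _, _ => False
  end.
End Classical.

(* amplitudes in an algebraically closed numeric field C (e.g. complex numbers);
   a one-cell operator is a matrix m with  m s t = <s| m |t>. *)
Record CQTM (C : numClosedFieldType) (SQ : finType) := MkCQTM {
  q_K : finType;
  q_s : q_K;
  q_SC : finType;
  q_cb : q_SC;
  q_cnb : q_SC;
  q_A : finType;                  (* index set of the finite set A *)
  q_op : q_A -> q_SC -> SQ -> SQ -> C;
  q_delta : q_K -> q_SC -> (q_K + halt) * dir * q_A }.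

Section Quantum.
Variables (C : numClosedFieldType) (SQ : finType) (bQ : SQ) (M : CQTM C SQ).

Definition admissible (m : q_SC M -> SQ -> SQ -> C) : Prop :=
  forall t1 t2 : SQ,
    \sum_(c : q_SC M) \sum_(s : SQ) (m c s t1)^* * m c s t2 = (t1 == t2)%:R.

Definition blank_test (c : q_SC M) (s t : SQ) : C :=
  if c == q_cb M then ((s == bQ) && (t == bQ))%:R
  else if c == q_cnb M then ((s == t) && (s != bQ))%:R else 0.

Definition cqtm_valid : Prop :=
  [/\ q_cb M != q_cnb M,
      forall a, admissible (q_op a) &
      exists a0, forall c s t, q_op a0 c s t = blank_test c s t].

(* Semantics on a finite window of cells -N..N (index j <-> position j - N).
   Cells outside the window are |#> and never touched as long as the head
   stays inside; a branch whose head leaves the window is discarded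
   (counted with mass 0). *)
Section Window.
Variable N : nat.
Definition wtape := {ffun 'I_(N.*2.+1) -> SQ}.
Definition qstate := wtape -> C.

Definition pos_idx (p : int) : option 'I_(N.*2.+1) :=
  if (0 <= p + N%:Z) then insub (absz (p + N%:Z)) else None.

Definition apply_cell (m : SQ -> SQ -> C) (i : 'I_(N.*2.+1)) (psi : qstate) : qstate :=
  fun t => \sum_(s : SQ) m (t i) s * psi [ffun j => if j == i then s else t j].

Definition norm2 (psi : qstate) : C := \sum_(t : wtape) `|psi t| ^+ 2.

Definition strip (w : seq SQ) : seq SQ :=
  let w1 := drop (find (fun a => a != bQ) w) w in
  rev (drop (find (fun a => a != bQ) (rev w1)) (rev w1)).

Definition wcontents (t : wtape) : seq SQ := [seq t j | j <- enum 'I_(N.*2.+1)].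

Definition tape_out_ok (psi : qstate) (w : seq SQ) : bool :=
  [exists t : wtape, [forall t' : wtape, (t' != t) ==> (psi t' == 0)]
                     && (strip (wcontents t) == w)].

Definition out_ok (o : output SQ) (hs : halt) (psi : qstate) : bool :=
  match o, hs with
  | OYes, HYes => true
  | ONo, HNo => true
  | OTape w, HH => tape_out_ok psi w
  | _, _ => false
  end.

(* total probability of the branches that halt within T steps with output o;
   psi is the unnormalized tape state of the branch, so its probability is
   norm2 psi *)
Fixpoint qmass (o : output SQ) (T : nat) (st : q_K M + halt) (c : q_SC M)
    (p : int) (psi : qstate) {struct T} : C :=
  match st with
  | inr hs => if out_ok o hs psi then norm2 psi else 0
  | inl q =>
    match T with
    | 0 => 0
    | T'.+1 =>
      let '(st', D, a) := q_delta q c in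
      let p' := move p D in
      match pos_idx p' with
      | None => 0
      | Some i => \sum_(c' : q_SC M) qmass o T' st' c' p' (apply_cell (q_op a c') i psi)
      end
    end
  end.
End Window.

Definition qprob (x : seq SQ) (o : output SQ) (T : nat) : C :=
  let N := (T + size x).+1 in
  let t0 : wtape N := [ffun j => place bQ x 1 ((nat_of_ord j)%:Z - N%:Z)] in
  qmass o T (inl (q_s M)) (q_cb M) 0 (fun t => (t == t0)%:R).
End Quantum.

Definition map_output (S T : Type) (g : S -> T) (o : output S) : output T :=
  match o with OYes => OYes | ONo => ONo | OTape w => OTape (map g w) end.

(* Main.v *)
(* A classical step is simulated by two quantum steps, on a tape that stays in a
   computational basis state throughout.  First the current cell is measured by a
   family that overwrites it at the same time: the operator for outcome a is
   |b><a|, where b is the symbol M_C writes on reading a.  Then the head moves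
   and the new cell is measured, which tells the controller the next symbol
   read.  On a basis state every such measurement has exactly one outcome of
   nonzero probability and leaves a basis state, so the quantum run is a single
   branch of probability 1 whose tape is the classical tape.  It halts within
   2 f(n) + 1 steps, with the same output. *)

Require Import Defs.
From HB Require Import structures.
From mathcomp Require Import all_boot all_order all_algebra.
From mathcomp Require Import zify.
From Stdlib Require Import FunctionalExtensionality.
Set Implicit Arguments. Unset Strict Implicit. Unset Printing Implicit Defensive.
Import Order.TTheory GRing.Theory Num.Theory.
Local Open Scope ring_scope.

Definition dir_code (D : dir) : option bool :=
  match D with DS => None | DL => Some false | DR => Some true end.
Definition dir_decode (e : option bool) : dir :=
  match e with None => DS | Some false => DL | Some true => DR end.
Lemma dir_codeK : cancel dir_code dir_decode. Proof. by case. Qed.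
HB.instance Definition _ := Finite.copy dir (can_type dir_codeK).

Lemma sum_option (R : nmodType) (T : finType) (F : option T -> R) :
  \sum_(c : option T) F c = F None + \sum_(a : T) F (Some a).
Proof.
rewrite (bigD1 None) //=; congr (_ + _).
rewrite (reindex_omap Some id) /=; last by case.
by apply: eq_bigl => a; rewrite eqxx.
Qed.

Lemma sum_eq_andb (R : pzSemiRingType) (T : finType) (b : T) (P : pred T) :
  \sum_(s : T) ((s == b) && P s)%:R = (P b)%:R :> R.
Proof. by rewrite (bigD1 b) //= eqxx big1 ?addr0 // => s /negbTE ->. Qed.

Lemma conjC_natb_mul (C : numClosedFieldType) (a b : bool) :
  (a%:R)^* * b%:R = (a && b)%:R :> C.
Proof. by rewrite conjC_nat -natrM mulnb. Qed.

Section Classical.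
Variables (S : finType) (blank : S) (MC : TM S).

Lemma iter_cstep_halted k (cf : cconfig MC) : chalted cf -> iter k (@cstep _ MC) cf = cf.
Proof. by case: cf => [[[q|hs] h] tp] //= _; elim: k => //= k ->. Qed.

Lemma crun_halted_eq x T1 T2 :
  chalted (crun blank MC x T1) -> chalted (crun blank MC x T2) ->
  crun blank MC x T1 = crun blank MC x T2.
Proof.
move=> h1 h2.
have later T T' : (T <= T')%N -> chalted (crun blank MC x T) ->
    crun blank MC x T' = crun blank MC x T.
  by move=> le_TT' hT; rewrite /crun -(subnK le_TT') iterD iter_cstep_halted.
by case: (leqP T1 T2) => [/later -> | /ltnW /later ->].
Qed.

Lemma cstep_head (cf : cconfig MC) : cf.1.2 - 1 <= (cstep cf).1.2 <= cf.1.2 + 1.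
Proof.
case: cf => [[[q|hs] h] tp] /=; last lia.
by case: (tm_delta q (tp h)) => [[p b] []] /=; lia.
Qed.
End Classical.

Section Window.
Variables (S : finType) (blank : S) (N : nat).
Local Notation tape := (wtape S N).
Local Notation cell := 'I_(N.*2.+1).

Lemma pos_idx_inside (p : int) : - N%:Z <= p <= N%:Z -> exists i, pos_idx N p = Some i.
Proof.
move=> /andP[lo hi]; rewrite /pos_idx.
have -> : 0 <= p + N%:Z by lia.
by rewrite insubT; [lia | eexists].
Qed.

Lemma pos_idx_val (p : int) (i : cell) : pos_idx N p = Some i -> p = (i : nat)%:Z - N%:Z.
Proof.
rewrite /pos_idx; case: ifP => // p_ge0; case: insubP => // u _ u_p [<-].
by rewrite u_p; lia.
Qed.

Lemma pos_idx_ord (i : cell) : pos_idx N ((i : nat)%:Z - N%:Z) = Some i.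
Proof.
by rewrite /pos_idx addrNK lez_nat /=; apply: valK.
Qed.

Definition upd (t : tape) (i : cell) (b : S) : tape := [ffun j => if j == i then b else t j].

Lemma upd_id (t : tape) i : upd t i (t i) = t.
Proof. by apply/ffunP => j; rewrite ffunE; case: eqP => // ->. Qed.

Lemma eq_upd (t t' : tape) i b : (t' == upd t i b) = (t' i == b) && (upd t' i (t i) == t).
Proof.
apply/eqP/andP => [->|[/eqP t'_i /eqP t'_off]].
  rewrite ffunE eqxx; split => //; apply/eqP/ffunP => j.
  by rewrite !ffunE; case: eqP => // ->.
apply/ffunP => j; rewrite ffunE; case: eqP => [->|/eqP j_i] //.
by rewrite -t'_off ffunE (negbTE j_i).
Qed.

Definition window_of (tp : int -> S) (t : tape) :=
  forall p, tp p = if pos_idx N p is Some j then t j else blank.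

Lemma window_of_write tp t h i b :
  window_of tp t -> pos_idx N h = Some i ->
  window_of (fun p => if p == h then b else tp p) (upd t i b).
Proof.
move=> enc h_i p; case: eqP => [->|/eqP p_h]; first by rewrite h_i ffunE eqxx.
rewrite enc; case p_j: (pos_idx N p) => [j|] //; rewrite ffunE.
case: eqP => // j_i; move: p_h; rewrite (pos_idx_val p_j) (pos_idx_val h_i) j_i.
by rewrite eqxx.
Qed.

Lemma window_of_support tp t p : window_of tp t -> tp p != blank -> - N%:Z <= p <= N%:Z.
Proof.
move=> enc; rewrite enc; case p_j: (pos_idx N p) => [j|]; last by rewrite eqxx.
by rewrite (pos_idx_val p_j); have := ltn_ord j; lia.
Qed.

Lemma window_of_ffun tp :
  (forall p, tp p != blank -> - N%:Z <= p <= N%:Z) ->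
  window_of tp [ffun j : cell => tp ((j : nat)%:Z - N%:Z)].
Proof.
move=> supp p; case p_j: (pos_idx N p) => [j|]; first by rewrite ffunE -(pos_idx_val p_j).
apply/eqP; apply: contraT => /supp /pos_idx_inside [j].
by rewrite p_j.
Qed.

Lemma wcontents_window_of tp t :
  window_of tp t -> wcontents t = [seq tp (n%:Z - N%:Z) | n <- iota 0 N.*2.+1].
Proof.
move=> enc; rewrite /wcontents -val_enum_ord -map_comp.
by apply: eq_map => j /=; rewrite enc pos_idx_ord.
Qed.
End Window.

Section BasisStates.
Variables (C : numClosedFieldType) (S : finType) (N : nat).
Local Notation tape := (wtape S N).

Definition ket (t : tape) : qstate C S N := fun t' => (t' == t)%:R.

Definition ketbra (b a : S) : S -> S -> C := fun s s' => ((s == b) && (s' == a))%:R.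

Lemma norm2_ket t : norm2 (ket t) = 1.
Proof.
rewrite /norm2 (bigD1 t) //= /ket eqxx normr1 expr1n big1 ?addr0 // => t' /negbTE ->.
by rewrite normr0 expr0n.
Qed.

Lemma apply_cell_ket m i t t' :
  apply_cell m i (ket t) t' = m (t' i) (t i) * (upd t' i (t i) == t)%:R.
Proof.
rewrite /apply_cell /ket (bigD1 (t i)) //= big1 ?addr0 // => s s_ti.
suff /negbTE -> : upd t' i s != t by rewrite mulr0.
by apply: contra s_ti => /eqP <-; rewrite ffunE eqxx.
Qed.

Lemma apply_cell_ketbra b a i t :
  apply_cell (ketbra b a) i (ket t) = if t i == a then ket (upd t i b) else fun _ => 0.
Proof.
apply: functional_extensionality => t'; rewrite apply_cell_ket /ketbra /ket.
by case: (t i == a); rewrite /= ?andbT ?andbF ?mul0r // eq_upd -natrM mulnb.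
Qed.

Lemma apply_cell0 m i : apply_cell m i (fun _ : tape => 0 : C) = fun _ => 0.
Proof.
by apply: functional_extensionality => t; rewrite /apply_cell big1 // => s _; rewrite mulr0.
Qed.

Lemma apply_cell_op0 i psi : apply_cell (fun _ _ => 0 : C) i psi = fun _ : tape => 0.
Proof.
by apply: functional_extensionality => t; rewrite /apply_cell big1 // => s _; rewrite mul0r.
Qed.
End BasisStates.

Section Qmass.
Variables (C : numClosedFieldType) (SQ : finType) (bQ : SQ) (M : CQTM C SQ) (N : nat).

Lemma blank_test_admissible : q_cb M != q_cnb M -> admissible (blank_test bQ (M:=M)).
Proof.
move=> cb_cnb t1 t2; rewrite (bigD1 (q_cb M)) // (bigD1 (q_cnb M)) /=; last by rewrite eq_sym.
rewrite [X in _ + (_ + X)]big1 ?addr0; last first.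
  move=> c /andP[c_cb c_cnb]; rewrite big1 // => s _.
  by rewrite /blank_test (negbTE c_cb) (negbTE c_cnb) mulr0.
have cnb_cb : (q_cnb M == q_cb M) = false by rewrite eq_sym (negbTE cb_cnb).
rewrite /blank_test eqxx cnb_cb eqxx.
under eq_bigr do rewrite conjC_natb_mul andbACA andbb.
under [X in _ + X]eq_bigr do rewrite conjC_natb_mul andbACA andbb -andbA.
rewrite !sum_eq_andb.
case: (t1 =P bQ) => [->|_]; first by rewrite andbF addr0 eq_sym.
by rewrite andbT add0r.
Qed.

Lemma qmass0 o T st c p : qmass bQ (M:=M) o T st c p (fun _ : wtape SQ N => 0) = 0.
Proof.
have norm2_0 : norm2 (fun _ : wtape SQ N => 0 : C) = 0.
  by rewrite /norm2 big1 // => t _; rewrite normr0 expr0n.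
elim: T st c p => [|T IH] [q|hs] c p /=; rewrite ?norm2_0 ?if_same //.
case: (q_delta q c) => [[st' D] a]; case: (pos_idx N (move p D)) => // i.
by rewrite big1 // => c' _; rewrite apply_cell0 IH.
Qed.

Lemma qmass_halted o T hs c p (psi : qstate C SQ N) :
  qmass bQ (M:=M) o T (inr hs) c p psi = if out_ok bQ o hs psi then norm2 psi else 0.
Proof. by case: T. Qed.

Lemma qmass_certain_step o T q c p st' D a i (t t' : wtape SQ N) c0 :
  q_delta q c = (st', D, a) -> pos_idx N (move p D) = Some i ->
  (forall c', apply_cell (q_op a c') i (ket C t) =
              if c' == c0 then ket C t' else fun _ => 0) ->
  qmass bQ (M:=M) o T.+1 (inl q) c p (ket C t) = qmass bQ o T st' c0 (move p D) (ket C t').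
Proof.
move=> /= -> -> op_t; rewrite (bigD1 c0) //= op_t eqxx big1 ?addr0 // => c' /negbTE c'_c0.
by rewrite op_t c'_c0 qmass0.
Qed.
End Qmass.

Section Strip.
Variables (T : finType) (b : T).

Lemma find_nonblank_pad a s :
  find (fun x => x != b) (nseq a b ++ s) = (a + find (fun x => x != b) s)%N.
Proof. by rewrite find_cat has_nseq eqxx andbF size_nseq. Qed.

Lemma strip_padded a r (w : seq T) : trimmed b w -> strip b (nseq a b ++ w ++ nseq r b) = w.
Proof.
case/orP => [/eqP ->|/andP[head_w last_w]].
  have find_blank n : find (fun x => x != b) (nseq n b) = n.
    by rewrite hasNfind ?has_nseq ?eqxx ?andbF ?size_nseq.
  rewrite /strip cat0s find_nonblank_pad find_blank.
  by rewrite [drop (a + r) _]drop_oversize ?size_cat ?size_nseq.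
have find_w s : find (fun x => x != b) (w ++ s) = 0%N.
  by case: w head_w {last_w} => [|x w'] /=; rewrite ?eqxx // => ->.
have find_rev_w : find (fun x => x != b) (rev w) = 0%N.
  case/lastP: w last_w {head_w find_w} => [|w' x] /=; first by rewrite eqxx.
  by rewrite last_rcons rev_rcons /= => ->.
rewrite /strip find_nonblank_pad find_w addn0 drop_size_cat ?size_nseq //.
rewrite rev_cat rev_nseq find_nonblank_pad find_rev_w addn0 drop_size_cat ?size_nseq //.
exact: revK.
Qed.

Lemma place_iota (w : seq T) (k : int) (N m : nat) :
  - N%:Z <= k -> k + (size w)%:Z <= m%:Z - N%:Z ->
  [seq place b w k (n%:Z - N%:Z) | n <- iota 0 m] =
  nseq (absz (k + N%:Z)) b ++ w ++ nseq (m - (absz (k + N%:Z)) - size w) b.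
Proof.
move=> lo hi; set a := (absz (k + N%:Z)).
rewrite [in LHS](_ : m = a + (size w + (m - a - size w)))%N; last lia.
rewrite !iotaD !map_cat add0n.
have blank_iota n0 m' : {in iota n0 m', forall n, n < a \/ a + size w <= n}%N ->
    [seq place b w k (n%:Z - N%:Z) | n <- iota n0 m'] = nseq m' b.
  move=> out; rewrite -[in RHS](size_iota n0 m').
  rewrite -(size_map (fun n => place b w k (n%:Z - N%:Z))).
  apply/all_pred1P/allP => _ /mapP[n /out n_out ->] /=.
  by rewrite /place; case: ifP => //; lia.
congr (_ ++ (_ ++ _)).
- by apply: blank_iota => n; rewrite mem_iota; lia.
- apply: (@eq_from_nth _ b); rewrite size_map size_iota // => i lt_i.
  rewrite (nth_map 0%N) ?size_iota // nth_iota // /place; case: ifP => [_|]; last lia.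
  by congr nth; lia.
- by apply: blank_iota => n; rewrite mem_iota; lia.
Qed.

Lemma strip_window (w : seq T) (k : int) (N : nat) :
  trimmed b w -> (forall p, place b w k p != b -> - N%:Z <= p <= N%:Z) ->
  strip b [seq place b w k (n%:Z - N%:Z) | n <- iota 0 N.*2.+1] = w.
Proof.
move=> w_trim supp.
have [k' [eq_k' lo hi]] : exists k', [/\ place b w k =1 place b w k', - N%:Z <= k'
    & k' + (size w)%:Z <= (N.*2.+1)%:Z - N%:Z].
  case: (w =P [::]) => [->|/eqP w_nil].
    by exists (- N%:Z); split => /=; [move=> p; rewrite /place !nth_nil !if_same | lia | lia].
  move: w_trim; rewrite /trimmed (negbTE w_nil) /= => /andP[head_w last_w].
  have size_w : (0 < size w)%N by rewrite lt0n size_eq0.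
  have at_k : place b w k k = head b w.
    by rewrite /place ifT ?subrr ?nth0 //; lia.
  have at_end : place b w k (k + (size w)%:Z - 1) = last b w.
    by rewrite /place ifT -?nth_last; [congr nth|]; lia.
  have := supp k; have := supp (k + (size w)%:Z - 1).
  rewrite at_k at_end => /(_ last_w) end_in /(_ head_w) k_in.
  by exists k; split => //; lia.
by rewrite (eq_map (fun n => eq_k' (n%:Z - N%:Z))) place_iota // strip_padded.
Qed.
End Strip.

Section Simulator.
Variables (C : numClosedFieldType) (S : finType) (blank : S) (MC : TM S).

(* [inr (p, D)]: the classical step has written its symbol; the head still has
   to move by [D] before the controller enters [p]. *)
Definition KQ : finType := (tm_K MC + tm_K MC * dir)%type.

(* Outcomes are [Some a] ("the cell holds a") and [None]; the blank-test
   outcome # is [Some blank], so the initial last outcome # correctly reports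
   the blank under the head.  Operation [None] is the blank test, and [Some w]
   measures the cell and writes [w], or writes back the symbol read when
   [w = None]. *)
Definition qop (a : option (option S)) (c : option S) : S -> S -> C :=
  match a, c with
  | None, _ => fun s s' =>
      if c == Some blank then ((s == blank) && (s' == blank))%:R
      else if c == None then ((s == s') && (s != blank))%:R else 0
  | Some w, Some r => ketbra C (odflt r w) r
  | Some _, None => fun _ _ => 0
  end.

Definition after_write (p : tm_K MC + halt) (D : dir) : KQ + halt :=
  match p with inl p' => inl (inr (p', D)) | inr hs => inr hs end.

Definition qdelta (k : KQ) (c : option S) : (KQ + halt) * dir * option (option S) :=
  match k, c with
  | inl q, Some r => let '(p, b, D) := tm_delta q r in (after_write p D, DS, Some (Some b))
  | inl _, None => (inr HNo, DS, None) (* unreachable *)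
  | inr (p', D), _ => (inl (inl p'), D, Some None)
  end.

Definition MQ : CQTM C S :=
  @MkCQTM C S KQ (inl (tm_s MC)) (option S : finType) (Some blank) None
    (option (option S) : finType) qop qdelta.

Lemma qop_write_admissible w : admissible (M:=MQ) (qop (Some w)).
Proof.
move=> t1 t2; rewrite sum_option big1 ?add0r => [|s _]; last by rewrite mulr0.
under eq_bigr do under eq_bigr do rewrite conjC_natb_mul andbACA andbb.
under eq_bigr do rewrite sum_eq_andb eq_sym (eq_sym t2).
exact: sum_eq_andb.
Qed.

Lemma MQ_valid : cqtm_valid blank MQ.
Proof.
split=> //; last by exists None.
by case=> [w|]; [exact: qop_write_admissible | exact: blank_test_admissible].
Qed.

Lemma apply_qop_write N w i (t : wtape S N) c :
  apply_cell (@q_op _ _ MQ (Some w) c) i (ket C t) =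
  if c == Some (t i) then ket C (upd t i (odflt (t i) w)) else fun _ => 0.
Proof.
case: c => [r|]; last exact: apply_cell_op0.
rewrite /= apply_cell_ketbra; case: (t i =P r) => [<-|ti_r]; first by rewrite eqxx.
by case: eqP => // [[/esym]].
Qed.

Definition halt_output (hs : halt) (tp : int -> S) (o : output S) : Prop :=
  match hs, o with
  | HYes, OYes => True
  | HNo, ONo => True
  | HH, OTape w => trimmed blank w /\ exists k, forall i, tp i = place blank w k i
  | _, _ => False
  end.

Section Run.
Variable N : nat.

Definition lift_state (st : tm_K MC + halt) : KQ + halt :=
  match st with inl q => inl (inl q) | inr hs => inr hs end.

Definition qmass_cfg o T (cf : cconfig MC) (t : wtape S N) : C :=
  let '(st, h, tp) := cf in
  qmass blank (M:=MQ) o T (lift_state st) (Some (tp h)) h (ket C t).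

Lemma qmass_cfg_halted o T hs h tp t :
  qmass_cfg o T (inr hs, h, tp) t = (out_ok blank o hs (ket C t))%:R.
Proof. by rewrite /= qmass_halted norm2_ket; case: out_ok. Qed.

Lemma qmass_cfg_cstep o T (cf : cconfig MC) t :
  window_of blank cf.2 t -> - N%:Z < cf.1.2 < N%:Z ->
  exists2 t', window_of blank (cstep cf).2 t' &
    qmass_cfg o T.+2 cf t = qmass_cfg o T (cstep cf) t'.
Proof.
case: cf => [[[q|hs] h] tp] win_t h_in; rewrite /= in win_t h_in; last first.
  by exists t; rewrite /= ?qmass_halted.
have [i h_i] : exists i, pos_idx N h = Some i by apply: pos_idx_inside; lia.
have t_h : t i = tp h by rewrite win_t h_i.
rewrite [cstep _]/=; case tr: (tm_delta q (tp h)) => [[p b] D].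
have win_t' := window_of_write b win_t h_i.
exists (upd t i b) => //.
have write : qmass_cfg o T.+2 (inl q, h, tp) t =
    qmass blank (M:=MQ) o T.+1 (after_write p D) (Some (tp h)) h (ket C (upd t i b)).
  apply: (qmass_certain_step (M := MQ) blank o T.+1 (p := h) (D := DS)
                              (a := Some (Some b)) (i := i)).
  - by rewrite /= tr.
  - exact: h_i.
  - by move=> c; rewrite apply_qop_write t_h.
rewrite write; case: p {tr write} => [p'|hs]; last by rewrite /= !qmass_halted.
have [i' h'_i'] : exists i', pos_idx N (move h D) = Some i'.
  by apply: pos_idx_inside; case: D; rewrite /=; lia.
apply: (qmass_certain_step (M := MQ) blank o T (D := D) (a := Some None) (i := i')) => // c.
by rewrite apply_qop_write upd_id win_t' h'_i'.
Qed.

Lemma qmass_cfg_iter o k T (cf : cconfig MC) t :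
  window_of blank cf.2 t -> - N%:Z + k%:Z <= cf.1.2 <= N%:Z - k%:Z ->
  exists2 t', window_of blank (iter k (@cstep _ MC) cf).2 t' &
    qmass_cfg o (k.*2 + T) cf t = qmass_cfg o T (iter k (@cstep _ MC) cf) t'.
Proof.
elim: k cf t => [|k IH] cf t win_t h_in; first by exists t.
have [|t1 win_t1 step] := qmass_cfg_cstep o (k.*2 + T) win_t; first lia.
rewrite doubleS !addSn step iterSr; apply: IH win_t1 _.
by have := cstep_head cf; lia.
Qed.

Lemma out_ok_ket hs tp (t : wtape S N) o :
  window_of blank tp t -> halt_output hs tp o -> out_ok blank o hs (ket C t).
Proof.
case: hs; case: o => //= w win_t [w_trim [k tp_w]].
apply/existsP; exists t; apply/andP; split.
  by apply/forallP => t'; apply/implyP => /negbTE t'_t; rewrite /ket t'_t.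
rewrite (wcontents_window_of win_t) (eq_map (fun n => tp_w _)).
apply/eqP/strip_window => // p; rewrite -tp_w; exact: window_of_support.
Qed.
End Run.

Lemma qprob_MQ_halting x o T0 TQ hs h tp :
  (T0.*2 <= TQ)%N -> crun blank MC x T0 = (inr hs, h, tp) -> halt_output hs tp o ->
  qprob blank MQ x o TQ = 1.
Proof.
move=> le_T0 run_T0 out_T0.
set N := (TQ + size x).+1.
have [T0_N x_N] : (T0 <= N)%N /\ (size x < N)%N by rewrite /N; lia.
set t0 := [ffun j : 'I_(N.*2.+1) => place blank x 1 ((j : nat)%:Z - N%:Z)].
have win_t0 : window_of blank (place blank x 1) t0.
  apply: window_of_ffun => p; rewrite /place.
  by case: ifP => [in_x _|_]; [lia | rewrite eqxx].
have -> : qprob blank MQ x o TQ = qmass_cfg o TQ (cinit blank MC x) t0 by [].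
rewrite -(subnKC le_T0).
have [|t' win_t' ->] :=
  qmass_cfg_iter o (k := T0) (TQ - T0.*2)%N (cf := cinit blank MC x) win_t0.
  by rewrite /=; lia.
rewrite -/(crun blank MC x T0) run_T0 in win_t' *.
by rewrite qmass_cfg_halted (out_ok_ket win_t' out_T0).
Qed.
End Simulator.

Lemma map_output_id (T : Type) (o : output T) : map_output id o = o.
Proof. by case: o => //= w; rewrite map_id. Qed.

Theorem theorem1 (C : numClosedFieldType) (S : finType) (blank : S)
    (MC : TM S) (f : nat -> nat) :
  runs_in_time blank MC f ->
  exists (SQ : finType) (bQ : SQ) (iota : S -> SQ),
    [/\ injective iota, iota blank = bQ &
    exists (MQ : CQTM C SQ) (c : nat),
      cqtm_valid bQ MQ /\
      forall x : seq S, is_input blank x ->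
      forall o : output S, tm_output blank MC x o ->
        qprob bQ MQ (map iota x) (map_output iota o) (c * f (size x) + c)%N = 1].
Proof.
move=> runs_f; exists S, blank, id; split=> //.
exists (MQ C blank MC), 2%N; split; first exact: MQ_valid.
move=> x x_input o [T]; rewrite map_id map_output_id.
case run_T: (crun blank MC x T) => [[[q|hs] h] tp] out_T; first by case: o out_T.
have [T0 [le_T0f halted_T0]] := runs_f x x_input.
have run_T0 : crun blank MC x T0 = (inr hs, h, tp).
  by rewrite -run_T; apply: crun_halted_eq; rewrite ?run_T.
apply: qprob_MQ_halting run_T0 out_T; lia.
Qed.
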